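(* Fix a polyhedron $V\subseteq\mathbb{R}^d$ and an outer support vector $\nu$ at $x\in V$. Inductively construct a finite set of jet frames for $V$ at $x$ by iterating the following procedure, beginning with the empty partial jet frame. For each of the finitely many partial jet frames $\bar\zeta$ already constructed (and whose iterated tangent cone $T_x^{\bar\zeta}V$ is nonzero): (a) if $\nu$ is orthogonal to a nonzero vector in $T_x^{\bar\zeta}V$, then append any one such unit vector to $\bar\zeta$; (b) if $\nu\cdot\zeta<0$ for all nonzero vectors $\zeta$ in $T_x^{\bar\zeta}V$, then create one new partial jet frame for each of the (finitely many) rays of $T_x^{\bar\zeta}V$ minimizing the angle with $\nu$, by appending to $\bar\zeta$ the unit vector along that ray. Then at least one of the finitely many jet frames constructed in this way is minimal.
   Context: A polyhedron $V$ is a finite intersection of closed half-spaces in $\mathbb{R}^d$; it need not have dimension $d$. A ray of a polyhedral cone is a one-dimensional face. Jets. Given a list $\bar\zeta=(\zeta_1,\dots,\zeta_r)$ of mutually orthogonal unit vectors in $\mathbb{R}^d$, put $J_{\bar\zeta}(\varepsilon)=(\varepsilon\zeta_1+\cdots+\varepsilon^r\zeta_r)/\sqrt{\varepsilon^2+\varepsilon^4+\cdots+\varepsilon^{2r}}$ (and $J_\varnothing\equiv0$ for the empty list). If $x\in V$ and $x+\varepsilon J_{\bar\zeta}(\varepsilon)\in V$ for all small $\varepsilon>0$, then $\bar\zeta$ is a partial jet frame at $x$ along $V$; if moreover $x+\varepsilon J_{\bar\zeta}(\varepsilon)$ lies in the relative interior of $V$ for all small $\varepsilon>0$, then $\bar\zeta$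 is a jet frame at $x$ along $V$. An outer support vector for $V$ at $x\in V$ is a vector $\nu\in\mathbb{R}^d$ with $\nu\cdot y\le\nu\cdot x$ for all $y\in V$. Lexicographic order on real vectors of varying lengths: $(a_1,\dots,a_r)<(b_1,\dots,b_s)$ if, after padding both with zeros, the first nonzero coordinate of $\bar a-\bar b$ is negative. The angle sequence of a jet frame $\bar\zeta$ (with respect to $\nu$) is $-(\nu\cdot\zeta_1,\dots,\nu\cdot\zeta_r)$. A jet frame $\bar\zeta$ at $x$ along $V$ is minimal if its angle sequence is lexicographically smallest (i.e. less than or equal to the angle sequence of every jet frame $\bar\zeta'$ at $x$ along $V$). Tangent cones. $T_xV=\mathbb{R}_{\ge0}\{\zeta\in\mathbb{R}^d : x+\zeta\in V\}$. For a partial jet frame $\bar\zeta$ at $x$ along $V$, let $\bar\zeta^\perp$ be the subspace orthogonal to all vectors of $\bar\zeta$ and let $\xi=J_{\bar\zeta}(\varepsilon)$ for sufficiently small $\varepsilon>0$; the iterated tangent cone is $T_x^{\bar\zeta}V=T_\xi\big((\xi+\bar\zeta^\perp)\cap T_xV\big)$, which does not depend on the small $\varepsilon$. For the empty frame it is $T_xV$. *)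

(* Defs.v *)
From mathcomp Require Export all_boot all_order all_algebra.
From mathcomp Require Export all_classical all_reals all_analysis.
Export Order.TTheory GRing.Theory Num.Theory numFieldNormedType.Exports.

Set Implicit Arguments.
Unset Strict Implicit.
Unset Printing Implicit Defensive.

Local Open Scope classical_set_scope.
Local Open Scope ring_scope.

Section Euclidean.
Variables (R : realType) (d : nat).
Implicit Types (u v y : 'rV[R]_d) (V F C : set 'rV[R]_d).

Definition dot u v : R := \sum_(i < d) u 0 i * v 0 i.

(* The norm provided by MathComp-Analysis on 'rV[R]_d is the sup norm. *)
Definition enorm u : R := Num.sqrt (dot u u).

Definition angle u v : R := acos (dot u v / (enorm u * enorm v)).

Definition affine_hull V : set 'rV[R]_d :=
  [set y | exists (n : nat) (a : 'I_n -> R) (p : 'I_n -> 'rV[R]_d),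
     [/\ forall i, V (p i), \sum_i a i = 1 & y = \sum_i a i *: p i]].

Definition relative_interior V : set 'rV[R]_d :=
  [set y | V y /\ \forall z \near y, affine_hull V z -> V z].

Definition is_polyhedron V : Prop :=
  exists (n : nat) (a : 'I_n -> 'rV[R]_d) (b : 'I_n -> R),
    (forall i, a i != 0) /\ V = [set y | forall i, dot (a i) y <= b i].

Definition is_outer_support_vector nu V x : Prop :=
  V x /\ forall y, V y -> dot nu y <= dot nu x.

Definition is_face F C : Prop :=
  exists u y0, is_outer_support_vector u C y0 /\
    F = [set y | C y /\ dot u y = dot u y0].

Definition is_ray F C : Prop :=
  is_face F C /\
  exists p u, u != 0 /\ affine_hull F = [set y | exists t : R, y = p + t *: u].

(* w is the unit vector along the ray F of C. *)
Definition ray_unit_vector F C w : Prop := [/\ is_ray F C, F w & enorm w = 1].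

Definition min_angle_ray_unit_vector nu C w : Prop :=
  exists2 F, ray_unit_vector F C w &
    forall F' w', ray_unit_vector F' C w' -> angle nu w <= angle nu w'.

Definition tangent_cone x V : set 'rV[R]_d :=
  [set y | exists c z, [/\ 0 <= c :> R, V (x + z) & y = c *: z]].

End Euclidean.

Section Jets.
Variables (R : realType) (d : nat).
Implicit Types (nu x w : 'rV[R]_d) (V : set 'rV[R]_d) (zs : seq 'rV[R]_d).

Definition orthonormal_list zs : Prop :=
  forall i j, (i < size zs)%N -> (j < size zs)%N ->
    dot zs`_i zs`_j = (i == j)%:R.

Definition jet zs (e : R) : 'rV[R]_d :=
  (Num.sqrt (\sum_(i < size zs) e ^+ (2 * i.+1)))^-1 *:
    \sum_(i < size zs) e ^+ i.+1 *: zs`_i.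

Definition is_partial_jet_frame x V zs : Prop :=
  [/\ orthonormal_list zs, V x & \forall e \near 0^'+, V (x + e *: jet zs e)].

Definition is_jet_frame x V zs : Prop :=
  is_partial_jet_frame x V zs /\
  \forall e \near 0^'+, relative_interior V (x + e *: jet zs e).

Definition angle_seq nu zs : seq R := [seq - dot nu z | z <- zs].

(* Reading a`_i past the end of a yields 0, which implements the padding. *)
Definition lex_lt (a b : seq R) : Prop :=
  exists2 k : nat, (forall i : nat, (i < k)%N -> a`_i - b`_i = 0) &
    a`_k - b`_k < 0.

Definition lex_le (a b : seq R) : Prop :=
  lex_lt a b \/ forall i : nat, a`_i = b`_i.

Definition is_minimal_jet_frame nu x V zs : Prop :=
  is_jet_frame x V zs /\
  forall zs', is_jet_frame x V zs' ->
    lex_le (angle_seq nu zs) (angle_seq nu zs').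

Definition orthogonal_list zs : set 'rV[R]_d :=
  [set v | forall i, (i < size zs)%N -> dot zs`_i v = 0].

(* T_xi((xi + zs^perp) /\ T_x V) for xi = jet zs e with e > 0 small.  For a
   partial jet frame zs along a polyhedron this cone is the same for all small
   e, so it is the set of the vectors that belong to it for all small e. *)
Definition iterated_tangent_cone x V zs : set 'rV[R]_d :=
  [set v | \forall e \near 0^'+,
     tangent_cone (jet zs e)
       ([set jet zs e + w | w in orthogonal_list zs] `&` tangent_cone x V) v].

(* The situation of step (a). *)
Definition has_orthogonal_direction nu x V zs : Prop :=
  exists2 w, iterated_tangent_cone x V zs w & w != 0 /\ dot nu w = 0.

(* The situation of step (b). *)
Definition all_directions_negative nu x V zs : Prop :=
  forall w, iterated_tangent_cone x V zs w -> w != 0 -> dot nu w < 0.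

(* sel zs is the vector that step (a) appends to zs.  A frame is constructed
   along only one sequence of steps, so an arbitrary choice at every execution
   of step (a) amounts to an arbitrary function sel. *)
Definition valid_selection nu x V (sel : seq 'rV[R]_d -> 'rV[R]_d) : Prop :=
  forall zs, is_partial_jet_frame x V zs ->
    has_orthogonal_direction nu x V zs ->
    [/\ iterated_tangent_cone x V zs (sel zs), enorm (sel zs) = 1
      & dot nu (sel zs) = 0].

Inductive constructed nu x V (sel : seq 'rV[R]_d -> 'rV[R]_d) :
    seq 'rV[R]_d -> Prop :=
| constructed_nil : constructed nu x V sel [::]
| constructed_orthogonal zs :
    constructed nu x V sel zs ->
    iterated_tangent_cone x V zs <> [set 0] ->
    has_orthogonal_direction nu x V zs ->
    constructed nu x V sel (rcons zs (sel zs))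
| constructed_ray zs w :
    constructed nu x V sel zs ->
    iterated_tangent_cone x V zs <> [set 0] ->
    all_directions_negative nu x V zs ->
    min_angle_ray_unit_vector nu (iterated_tangent_cone x V zs) w ->
    constructed nu x V sel (rcons zs w).

(* The output of the procedure: the frames to which no step applies any more
   because the iterated tangent cone is zero. *)
Definition output nu x V (sel : seq 'rV[R]_d -> 'rV[R]_d) :
    set (seq 'rV[R]_d) :=
  [set zs | constructed nu x V sel zs /\
            iterated_tangent_cone x V zs = [set 0]].

End Jets.

(* Main.v *)
Require Import Defs.
From mathcomp Require Import ring lra.

(** Write the polyhedron as the set of all [y] with [dot (a i) y <= b i] for all
    [i], and let [zs] be a partial jet frame at [x]. The inequalities that are
    equalities at [x] and whose normal vectors are orthogonal to [zs] are called
    tight. The sign of an inequality along a jet is decided by the first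
    nonzero product of its normal vector with a member of the frame. Hence the
    iterated tangent cone of [zs] consists of the vectors [v] orthogonal to [zs]
    with [dot (a i) v <= 0] for every tight [i] ([iterated_tangent_coneE]), and
    the partial jet frames are the lists obtained by repeatedly appending a unit
    vector of the current cone ([partial_jet_frameP]). A frame with zero cone is
    a jet frame ([conic_frame_jet_frame]). Conversely the cone of a jet frame is
    a linear subspace ([jet_frame_linear]), so every jet frame can be completed
    to a frame with zero cone, without increasing its angle sequence
    ([linear_frame_extension]).

    Call a unit vector of a cone optimal if it minimizes the angle with [nu]
    among all nonzero vectors of the cone. If [nu] is nonpositive on the cone,
    the unit vectors of the cone orthogonal to [nu] are optimal; if [nu] is
    negative on all nonzero vectors of the cone, the optimal vectors are exactly
    the unit vectors along the rays that minimize the angle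
    ([min_angle_ray_optimal]), and there are finitely many of them
    ([finite_optimal]). Appending an optimal vector preserves nonpositivity of
    [nu] on the cone ([nonpositive_rcons]). So the procedure appends optimal
    vectors only, and it goes on until the cone is zero.

    It remains to compare the procedure with an arbitrary frame with zero cone
    ([built_competitive]). Both proceed side by side, as long as the angle
    sequences agree. Consider the span of each of the two current frames,
    enlarged by the vectors of its cone on which [nu] vanishes. Appending a
    vector orthogonal to [nu] does not change this enlarged span, so the choices
    made in these steps do not matter. When no such vector is left in one of the
    two cones, then none is left in the other, by equality of dimensions, and
    both frames span the same subspace; so their cones are equal. If the
    competitor then appends an optimal vector, the procedure has a branch that
    appends the same vector; otherwise the procedure wins. The lexicographically
    smallest of the finitely many outputs is therefore minimal. *)

Set Implicit Arguments.
Unset Strict Implicit.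
Unset Printing Implicit Defensive.

Local Open Scope classical_set_scope.
Local Open Scope ring_scope.

(** * The dot product *)

Section Dot.
Variables (R : realType) (d : nat).
Implicit Types (u v w y : 'rV[R]_d) (zs : seq 'rV[R]_d) (c : R).

Lemma dotC u v : dot u v = dot v u.
Proof. by apply: eq_bigr => i _; rewrite mulrC. Qed.

Lemma dotDr u v w : dot u (v + w) = dot u v + dot u w.
Proof. by rewrite -big_split; apply: eq_bigr => i _; rewrite mxE mulrDr. Qed.

Lemma dotZr c u v : dot u (c *: v) = c * dot u v.
Proof.
by rewrite /dot big_distrr; apply: eq_bigr => i _; rewrite mxE /= mulrCA.
Qed.

Lemma dot0r u : dot u 0 = 0.
Proof. by rewrite -(scale0r 0) dotZr mul0r. Qed.

Lemma dotNr u v : dot u (- v) = - dot u v.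
Proof. by rewrite -scaleN1r dotZr mulN1r. Qed.

Lemma dotBr u v w : dot u (v - w) = dot u v - dot u w.
Proof. by rewrite dotDr dotNr. Qed.

Lemma dotDl u v w : dot (u + v) w = dot u w + dot v w.
Proof. by rewrite dotC dotDr !(dotC w). Qed.

Lemma dotZl c u v : dot (c *: u) v = c * dot u v.
Proof. by rewrite dotC dotZr dotC. Qed.

Lemma dot0l u : dot 0 u = 0.
Proof. by rewrite dotC dot0r. Qed.

Lemma dotNl u v : dot (- u) v = - dot u v.
Proof. by rewrite dotC dotNr dotC. Qed.

Lemma dot_sumr u (I : Type) (r : seq I) (P : pred I) (F : I -> 'rV[R]_d) :
  dot u (\sum_(i <- r | P i) F i) = \sum_(i <- r | P i) dot u (F i).
Proof. by apply: (big_morph (dot u) (dotDr u) (dot0r u)). Qed.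

Lemma dot_ge0 u : 0 <= dot u u.
Proof. by apply: sumr_ge0 => i _; rewrite -expr2 sqr_ge0. Qed.

Lemma dot_eq0 u : (dot u u == 0) = (u == 0).
Proof.
apply/eqP/eqP => [uu0|->]; last by rewrite dot0r.
apply/rowP => i; rewrite mxE; apply/eqP.
rewrite -sqrf_eq0 expr2; apply/eqP.
have := psumr_eq0P (P := xpredT) (F := fun i => u 0 i * u 0 i).
by apply=> // j _; rewrite -expr2 sqr_ge0.
Qed.

Lemma dot_gt0 u : (0 < dot u u) = (u != 0).
Proof. by rewrite lt_def dot_ge0 andbT dot_eq0. Qed.

Lemma enorm_ge0 u : 0 <= enorm u.
Proof. exact: sqrtr_ge0. Qed.

Lemma enorm_gt0 u : (0 < enorm u) = (u != 0).
Proof. by rewrite sqrtr_gt0 dot_gt0. Qed.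

Lemma sqr_enorm u : enorm u ^+ 2 = dot u u.
Proof. by rewrite sqr_sqrtr ?dot_ge0. Qed.

Lemma enorm_eq1 u : enorm u = 1 <-> dot u u = 1.
Proof.
split=> [u1|u1]; first by rewrite -sqr_enorm u1 expr1n.
by rewrite /enorm u1 sqrtr1.
Qed.

Lemma enorm_unit u : u != 0 -> enorm ((enorm u)^-1 *: u) = 1.
Proof.
move=> u0; apply/enorm_eq1; rewrite dotZl dotZr -sqr_enorm.
have : enorm u != 0 by rewrite gt_eqF ?enorm_gt0.
by move=> ?; field.
Qed.

Lemma unit_neq0 u : dot u u = 1 -> u != 0.
Proof. by move=> u1; rewrite -dot_gt0 u1 ltr01. Qed.

(** The Cauchy-Schwarz inequality when one of the vectors is a unit. *)
Lemma le_dot_unit u w : dot w w = 1 -> `|dot u w| <= enorm u.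
Proof.
move=> w1; rewrite -(@ler_pXn2r _ 2) ?nnegrE ?enorm_ge0 //.
rewrite real_normK ?num_real // sqr_enorm.
have := dot_ge0 (u - dot u w *: w).
rewrite dotBr !dotDl !dotNl !dotZr !dotZl w1 (dotC w u).
by nra.
Qed.

Lemma continuous_dot u : continuous (dot u).
Proof.
apply: continuous_big => [|i _ y]; first exact: add_continuous.
by apply: cvgMl_tmp; [exact: nbhs_filter|exact: coord_continuous].
Qed.

Lemma dot_entry u i : u 0 i ^+ 2 <= dot u u.
Proof.
rewrite /dot (bigD1 i) //= -expr2 lerDl sumr_ge0 // => j _.
by rewrite -expr2 sqr_ge0.
Qed.

End Dot.

(** * Orthonormal lists *)

Section Orthonormal.
Variables (R : realType) (d : nat).
Implicit Types (u v w y : 'rV[R]_d) (zs : seq 'rV[R]_d) (c : R).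

Lemma orthogonal_nil u : orthogonal_list [::] u.
Proof. by []. Qed.

Lemma orthogonal_rcons zs w u :
  orthogonal_list (rcons zs w) u <-> orthogonal_list zs u /\ dot w u = 0.
Proof.
split=> [h|[h wu] i].
  split=> [i lti|]; last first.
    by move: (h (size zs)); rewrite nth_rcons ltnn eqxx size_rcons; apply.
  by move: (h i); rewrite nth_rcons lti size_rcons; apply; apply: ltnW.
rewrite size_rcons ltnS leq_eqVlt nth_rcons => /predU1P[->|lti].
  by rewrite ltnn eqxx.
by rewrite lti; apply: h.
Qed.

Lemma orthogonalD zs u v :
  orthogonal_list zs u -> orthogonal_list zs v -> orthogonal_list zs (u + v).
Proof. by move=> ou ov i lti; rewrite dotDr ou // ov // addr0. Qed.

Lemma orthogonalZ zs c u :
  orthogonal_list zs u -> orthogonal_list zs (c *: u).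
Proof. by move=> ou i lti; rewrite dotZr ou // mulr0. Qed.

Lemma orthogonalN zs u : orthogonal_list zs u -> orthogonal_list zs (- u).
Proof. by move=> ou i lti; rewrite dotNr ou // oppr0. Qed.

Lemma orthogonal0 zs : orthogonal_list zs 0.
Proof. by move=> i _; rewrite dot0r. Qed.

Lemma orthonormal_rcons zs w :
  orthonormal_list (rcons zs w) <->
  [/\ orthonormal_list zs, orthogonal_list zs w & dot w w = 1].
Proof.
split=> [h|[h hw w1] i j].
  have n i j : (i <= size zs)%N -> (j <= size zs)%N ->
      dot (rcons zs w)`_i (rcons zs w)`_j = (i == j)%:R.
    by move=> li lj; apply: h; rewrite size_rcons ltnS.
  split=> [i j li lj|i li|].
  - by move: (n i j (ltnW li) (ltnW lj)); rewrite !nth_rcons li lj.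
  - move: (n i (size zs) (ltnW li) (leqnn _)).
    by rewrite !nth_rcons li ltnn eqxx ltn_eqF.
  - move: (n (size zs) (size zs) (leqnn _) (leqnn _)).
    by rewrite !nth_rcons ltnn !eqxx.
rewrite size_rcons !ltnS !nth_rcons (leq_eqVlt i) (leq_eqVlt j).
move=> /predU1P[->|li] /predU1P[->|lj].
- by rewrite ltnn !eqxx.
- by rewrite ltnn eqxx lj dotC hw // gtn_eqF.
- by rewrite ltnn eqxx li hw // ltn_eqF.
- by rewrite li lj h.
Qed.

Lemma orthonormal_size zs : orthonormal_list zs -> (size zs <= d)%N.
Proof.
move=> o; pose M := \matrix_(i < size zs, j < d) zs`_i 0 j.
apply: (@mulmx1_min _ _ _ M M^T); apply/matrixP => i j.
rewrite !mxE -(o i j) //; by apply: eq_bigr => k _; rewrite !mxE.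
Qed.

(** The linear combination of the members of [zs] with coefficients [c]. *)
Definition lin zs (c : nat -> R) : 'rV[R]_d := \sum_(i < size zs) c i *: zs`_i.

Lemma orthogonal_lin zs (c : nat -> R) u :
  orthogonal_list zs u -> dot u (lin zs c) = 0.
Proof.
move=> o; rewrite dot_sumr big1 // => i _.
by rewrite dotZr dotC o // mulr0.
Qed.

Lemma dot_lin zs (c : nat -> R) j : orthonormal_list zs -> (j < size zs)%N ->
  dot zs`_j (lin zs c) = c j.
Proof.
move=> o lj; rewrite dot_sumr (bigD1 (Ordinal lj)) //= dotZr o // eqxx mulr1.
rewrite big1 ?addr0 // => i; rewrite -val_eqE /= => ij.
by rewrite dotZr o // eq_sym (negbTE ij) mulr0.
Qed.

(** The component of [v] orthogonal to the list [zs]. *)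
Definition reject zs v : 'rV[R]_d := v - lin zs (fun i => dot zs`_i v).

Lemma reject_orthogonal zs v :
  orthonormal_list zs -> orthogonal_list zs (reject zs v).
Proof. by move=> o i li; rewrite dotBr dot_lin // subrr. Qed.

Lemma dot_reject zs u v : orthogonal_list zs u -> dot u (reject zs v) = dot u v.
Proof. by move=> o; rewrite dotBr orthogonal_lin // subr0. Qed.

(** A longer orthonormal list spans a nonzero vector that is orthogonal to
    all members of a shorter list. *)
Lemma exists_orthogonal_lin zs zs' :
  (size zs < size zs')%N -> orthonormal_list zs' ->
  exists c : nat -> R, lin zs' c != 0 /\ orthogonal_list zs (lin zs' c).
Proof.
move=> lt o.
pose A := \matrix_(i < size zs', j < size zs) dot zs`_j zs'`_i.
have : kermx A != 0.
  rewrite kermx_eq0 /row_free; apply: contraTneq lt => <-.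
  by rewrite -leqNgt rank_leq_col.
case/rowV0Pn=> c /sub_kermxP cA c0.
pose c' n := if insub n is Some i then c 0 i else 0.
have c'E (i : 'I_(size zs')) : c' i = c 0 i by rewrite /c' valK.
exists c'; split.
  apply: contraNneq c0 => l0; apply/eqP/rowP => i.
  by rewrite mxE -c'E -(dot_lin c' o) // l0 dot0r.
move=> j lj; move/rowP/(_ (Ordinal lj)): cA; rewrite !mxE => <-.
rewrite dot_sumr; apply: eq_bigr => i _.
by rewrite dotZr !mxE c'E.
Qed.

End Orthonormal.

(** * Leading terms of jets *)

Section Moment.
Variables (R : realType) (d : nat).
Implicit Types (u v w y : 'rV[R]_d) (zs : seq 'rV[R]_d) (c e g t s : R).

Lemma near0_ex (P : R -> Prop) :
  (\forall e \near 0^'+, P e) -> exists2 e, 0 < e & P e.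
Proof.
move=> H; have pf := at_right_proper_filter (0 : R).
have [e [e0 Pe]] := @filter_ex _ _ pf _ (filterI (nbhs_right_gt (0 : R)) H).
by exists e.
Qed.

Lemma near0_mul_lt s g : 0 < g -> \forall t \near 0^'+, t * s < g.
Proof.
move=> g0; near=> t.
have t0 : 0 < t by [].
have s0 : 0 < `|s| + 1 by rewrite ltr_wpDl.
have : t < g / (`|s| + 1) by near: t; apply: nbhs_right_lt; rewrite divr_gt0.
rewrite ltr_pdivlMr //; apply: le_lt_trans.
rewrite ler_pM2l //; apply: (le_trans (ler_norm s)).
by rewrite lerDl.
Unshelve. all: by end_near. Qed.

(** Finitely many linear inequalities that hold at [y] continue to hold
    along [v] if those that are equalities at [y] do. *)
Lemma near_feasible m (A : 'I_m -> 'rV[R]_d) (B : 'I_m -> R)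
    (P : 'I_m -> Prop) y v :
  (forall i, P i -> dot (A i) y <= B i) ->
  (forall i, P i -> dot (A i) y = B i -> dot (A i) v <= 0) ->
  \forall t \near 0^'+, forall i, P i -> dot (A i) (y + t *: v) <= B i.
Proof.
move=> AB Av; apply: filter_forall => i.
have [Pi|nPi] := pselect (P i); last by apply: nearW => t /nPi.
have := AB i Pi; rewrite le_eqVlt => /predU1P[E|lt].
  near=> t => _; rewrite dotDr dotZr E gerDl mulr_ge0_le0 //.
  by apply: Av.
near=> t => _; rewrite dotDr dotZr addrC -lerBrDr ltW //; near: t.
by apply: near0_mul_lt; rewrite subr_gt0.
Unshelve. all: by end_near. Qed.

Lemma lin_rcons zs w (c : nat -> R) :
  lin (rcons zs w) c = lin zs c + c (size zs) *: w.
Proof.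
rewrite /lin size_rcons big_ord_recr /= nth_rcons ltnn eqxx.
by congr (_ + _); apply: eq_bigr => i _; rewrite nth_rcons ltn_ord.
Qed.

(** The numerator of [jet zs e]. *)
Definition moment zs e : 'rV[R]_d := lin zs (fun i => e ^+ i.+1).

(** The jet is a multiple of its numerator with a factor between 0 and [e^-1].
    For the empty list, where both sides vanish, the factor [e^-1] is taken. *)
Lemma jet_moment zs e : 0 < e ->
  exists k, [/\ 0 < k, k * e <= 1 & jet zs e = k *: moment zs e].
Proof.
move=> e0; have ei0 : 0 < e^-1 by rewrite invr_gt0.
case: zs => [|z zs].
  exists e^-1; rewrite mulVf ?gt_eqF //; split=> //.
  by rewrite /jet /moment /lin !big_ord0 !scaler0.
rewrite /jet; set S := \sum_(i < _) e ^+ _.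
have S1 : e ^+ 2 <= S.
  rewrite /S big_ord_recl /= lerDl sumr_ge0 // => i _.
  by rewrite exprn_ge0 // ltW.
have S2 : e <= Num.sqrt S.
  by rewrite -(ger0_norm (ltW e0)) -sqrtr_sqr ler_wsqrtr.
have S0 : 0 < Num.sqrt S by apply: lt_le_trans S2.
exists (Num.sqrt S)^-1; split=> //; first by rewrite invr_gt0.
by rewrite mulrC ler_pdivrMr // mul1r.
Qed.

Lemma near_jet_lt zs u g : 0 < g ->
  \forall e \near 0^'+, dot u (e *: jet zs e) < g.
Proof.
move=> g0; near=> e; have e0 : 0 < e by [].
have e1 : e <= 1 by near: e; apply: nbhs_right_le.
have [k [k0 ke ->]] := jet_moment zs e0.
pose M := \sum_(i < size zs) `|dot u zs`_i|.
have uM : dot u (moment zs e) <= e * M.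
  rewrite dot_sumr /M mulr_sumr ler_sum // => i _; rewrite dotZr exprS -mulrA.
  rewrite ler_pM2l //; apply: (le_trans (ler_norm _)); rewrite normrM.
  by rewrite ler_piMl // ger0_norm ?exprn_ge0 ?exprn_ile1 // ltW.
have eM : 0 <= e * M by rewrite mulr_ge0 ?sumr_ge0 // ltW.
rewrite scalerA dotZr mulrC; apply: (@le_lt_trans _ _ (e * M)); last first.
  by near: e; apply: near0_mul_lt.
apply: (@le_trans _ _ (e * M * (e * k))).
  by rewrite ler_wpM2r // mulr_ge0 // ltW.
by rewrite ler_piMr // mulrC.
Unshelve. all: by end_near. Qed.

(** For small positive [e], [dot u (moment zs e)] is below a negative multiple
    of the last power of [e] in [moment zs e], hence negative. Unlike mere
    negativity, this is stable under appending a vector to [zs], which adds a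
    term of higher order. *)
Definition moment_neg zs u : Prop :=
  exists2 c, 0 < c &
    \forall e \near 0^'+, dot u (moment zs e) <= - (c * e ^+ size zs).

Lemma dot_moment_rcons zs w u e :
  dot u (moment (rcons zs w) e) =
  dot u (moment zs e) + e ^+ (size zs).+1 * dot u w.
Proof. by rewrite /moment lin_rcons dotDr dotZr. Qed.

Lemma moment_neg_rcons zs w u : moment_neg zs u -> moment_neg (rcons zs w) u.
Proof.
move=> [c c0 H]; exists (c / 2); first by rewrite divr_gt0.
near=> e; have e0 : 0 < e by [].
have h1 : dot u (moment zs e) <= - (c * e ^+ size zs) by near: e.
have e1 : e <= 1 by near: e; apply: nbhs_right_le.
have h2 : e * dot u w < c / 2.
  by near: e; apply: near0_mul_lt; rewrite divr_gt0.
rewrite dot_moment_rcons size_rcons !exprS.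
have p0 : 0 < e ^+ size zs by rewrite exprn_gt0.
set p := e ^+ size zs in h1 p0 *; set q := dot u w in h2 *.
have h3 : p * (e * q) <= p * (c / 2) by rewrite ler_pM2l // ltW.
have h4 : c / 2 * (e * p) <= c / 2 * p.
  by rewrite ler_pM2l ?divr_gt0 // ler_piMl // ltW.
by lra.
Unshelve. all: by end_near. Qed.

Lemma moment_neg_last zs w u :
  orthogonal_list zs u -> dot u w < 0 -> moment_neg (rcons zs w) u.
Proof.
move=> o neg; exists (- dot u w); first by rewrite oppr_gt0.
apply: nearW => e; rewrite dot_moment_rcons orthogonal_lin // size_rcons add0r.
by rewrite mulNr opprK mulrC.
Qed.

(** The sign of [dot u (moment zs e)] for small [e] is that of the first
    nonzero product of [u] with a member of [zs]. *)
Lemma moment_sign zs u :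
  [\/ orthogonal_list zs u, moment_neg zs u | moment_neg zs (- u)].
Proof.
elim/last_ind: zs => [|zs w [IH|IH|IH]]; first exact: Or31.
- have [lt|lt|E] := ltgtP (dot u w) 0.
  + by apply: Or32; apply: moment_neg_last.
  + apply: Or33; apply: moment_neg_last; first exact: orthogonalN.
    by rewrite dotNl oppr_lt0.
  + by apply: Or31; rewrite orthogonal_rcons dotC.
- by apply: Or32; apply: moment_neg_rcons.
- by apply: Or33; apply: moment_neg_rcons.
Qed.

Lemma moment_neg_near zs u :
  moment_neg zs u -> \forall e \near 0^'+, dot u (moment zs e) < 0.
Proof.
move=> [c c0 H]; near=> e; apply: (@le_lt_trans _ _ (- (c * e ^+ size zs))).
  by near: e.
by rewrite oppr_lt0 mulr_gt0 // exprn_gt0.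
Unshelve. all: by end_near. Qed.

Lemma moment_neg_not_orthogonal zs u :
  moment_neg zs u -> ~ orthogonal_list zs u.
Proof.
move=> H o; have [e _ neg] := near0_ex (moment_neg_near H).
by move: neg; rewrite orthogonal_lin // ltxx.
Qed.

(** An inequality holds along a jet when the jet stays on its boundary or
    leaves the boundary at a definite order. *)
Lemma moment_npos zs u :
  (\forall e \near 0^'+, dot u (moment zs e) <= 0) <->
  orthogonal_list zs u \/ moment_neg zs u.
Proof.
split=> [H|[uo|]].
- have [uo|neg|neg] := moment_sign zs u; [by left|by right|].
  have [e _ [h1 h2]] := near0_ex (filterI H (moment_neg_near neg)).
  by move: h2; rewrite dotNl oppr_lt0 ltNge h1.
- by apply: nearW => e; rewrite orthogonal_lin.
- by move=> /moment_neg_near; apply: filterS => e /ltW.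
Qed.

Lemma moment_npos_rcons zs w u :
  (\forall e \near 0^'+, dot u (moment (rcons zs w) e) <= 0) <->
  (\forall e \near 0^'+, dot u (moment zs e) <= 0) /\
  (orthogonal_list zs u -> dot u w <= 0).
Proof.
split=> [H|[]]; last first.
  move=> /moment_npos[uo /(_ uo) uw|neg _].
    near=> e; rewrite dot_moment_rcons orthogonal_lin // add0r.
    by rewrite mulr_ge0_le0 // exprn_ge0.
  by apply/moment_npos; right; apply: moment_neg_rcons.
have [uo|neg|neg] := moment_sign zs u.
- split=> [|_]; first by apply/moment_npos; left.
  have [e e0] := near0_ex H; rewrite dot_moment_rcons orthogonal_lin // add0r.
  by rewrite pmulr_rle0 ?exprn_gt0.
- split=> [|o]; first by apply/moment_npos; right.
  by case: (moment_neg_not_orthogonal neg).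
- have neg' := moment_neg_near (moment_neg_rcons w neg).
  have [e _ [/= h1]] := near0_ex (filterI H neg').
  by rewrite dotNl oppr_lt0 ltNge h1.
Unshelve. all: by end_near. Qed.

End Moment.

(** * Partial jet frames along a polyhedron *)

Section Frames.
Variables (R : realType) (d n : nat).
Variables (a : 'I_n -> 'rV[R]_d) (b : 'I_n -> R) (x : 'rV[R]_d).
Implicit Types (u v w y : 'rV[R]_d) (zs : seq 'rV[R]_d) (c e g t s : R).

(** The polyhedron of the inequalities [dot (a i) y <= b i]. *)
Definition halfspaces : set 'rV[R]_d := [set y | forall i, dot (a i) y <= b i].

(** The [i]th inequality is an equality at [x] and along the jets of [zs]. *)
Definition tight zs (i : 'I_n) : Prop :=
  dot (a i) x = b i /\ orthogonal_list zs (a i).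

(** An explicit form of the iterated tangent cone (see
    [iterated_tangent_coneE]); it depends only on the span of [zs]. *)
Definition frame_cone zs : set 'rV[R]_d :=
  [set v | orthogonal_list zs v /\ forall i, tight zs i -> dot (a i) v <= 0].

(** The lists obtained by repeatedly appending a unit vector of the current
    cone. These are the partial jet frames (see [partial_jet_frameP]). *)
Inductive conic_frame : seq 'rV[R]_d -> Prop :=
| conic_frame_nil : conic_frame [::]
| conic_frame_rcons zs w : conic_frame zs -> frame_cone zs w -> dot w w = 1 ->
    conic_frame (rcons zs w).

Lemma conic_frame_rconsP zs w :
  conic_frame (rcons zs w) <->
  [/\ conic_frame zs, frame_cone zs w & dot w w = 1].
Proof.
split=> [H|[*]]; last exact: conic_frame_rcons.
move E: (rcons zs w) H => s H.
case: H E => [|zs' w' f cw w1 /rcons_inj[-> ->//]].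
by case: (zs).
Qed.

Lemma conic_frame_prefix zs ts : conic_frame (zs ++ ts) -> conic_frame zs.
Proof.
elim/last_ind: ts => [|ts t IH]; first by rewrite cats0.
by rewrite -rcons_cat => /conic_frame_rconsP[/IH].
Qed.

Lemma conic_frame_orthonormal zs : conic_frame zs -> orthonormal_list zs.
Proof. by elim=> [//|zs' w _ IH [ow _] w1]; apply/orthonormal_rcons. Qed.

Lemma tight_rcons zs w i :
  tight (rcons zs w) i <-> tight zs i /\ dot (a i) w = 0.
Proof.
rewrite /tight; split=> [[ai /orthogonal_rcons[ozs wa]]|[[ai ozs] aw]].
  by split=> //; rewrite dotC.
by split=> //; apply/orthogonal_rcons; split=> //; rewrite dotC.
Qed.

Lemma frame_cone0 zs : frame_cone zs 0.
Proof. by split=> [|i _]; rewrite ?dot0r //; apply: orthogonal0. Qed.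

Lemma frame_coneZ zs c v : 0 <= c -> frame_cone zs v -> frame_cone zs (c *: v).
Proof.
move=> c0 [ov cv]; split=> [|i ti]; first exact: orthogonalZ.
by rewrite dotZr mulr_ge0_le0 // cv.
Qed.

Lemma frame_cone_normalize zs v : frame_cone zs v -> v != 0 ->
  frame_cone zs ((enorm v)^-1 *: v) /\
  dot ((enorm v)^-1 *: v) ((enorm v)^-1 *: v) = 1.
Proof.
move=> cv v0; split; last by apply/enorm_eq1/enorm_unit.
by apply: frame_coneZ; rewrite ?invr_ge0 ?enorm_ge0.
Qed.

(** Along [w], directions of the next cone lead back into the cone. *)
Lemma near_frame_cone zs w v : frame_cone zs w -> frame_cone (rcons zs w) v ->
  \forall t \near 0^'+, frame_cone zs (w + t *: v).
Proof.
move=> [ow cw] [/orthogonal_rcons[ov _] cv].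
have H : \forall t \near 0^'+, forall i, tight zs i ->
    dot (a i) (w + t *: v) <= 0.
  by apply: near_feasible => // i ti wi; apply: cv; apply/tight_rcons.
near=> t; split; last by near: t.
by apply: orthogonalD => //; apply: orthogonalZ.
Unshelve. all: by end_near. Qed.

(** Subtracting the component along [zs] preserves the tight inequalities. *)
Lemma frame_cone_reject zs v : orthonormal_list zs ->
  (forall i, tight zs i -> dot (a i) v <= 0) -> frame_cone zs (reject zs v).
Proof.
move=> o cv; split; first exact: reject_orthogonal.
by move=> i ti; rewrite dot_reject ?cv //; case: ti.
Qed.

Lemma dot_jet zs u e : orthogonal_list zs u -> dot u (jet zs e) = 0.
Proof.
move=> o; rewrite /jet dotZr -/(lin zs (fun i => e ^+ i.+1)).
by rewrite orthogonal_lin // mulr0.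
Qed.

Hypothesis Vx : halfspaces x.

(** Only the inequalities that are equalities at [x] matter for small [e]. *)
Lemma near_halfspaces_jet zs :
  (\forall e \near 0^'+, halfspaces (x + e *: jet zs e)) <->
  (forall i, dot (a i) x = b i ->
     \forall e \near 0^'+, dot (a i) (moment zs e) <= 0).
Proof.
split=> [H i xi|H].
  near=> e; have e0 : 0 < e by [].
  have [k [k0 _ jE]] := jet_moment zs e0.
  have : halfspaces (x + e *: jet zs e) by near: e.
  move/(_ i); rewrite dotDr xi gerDl jE !dotZr.
  by rewrite pmulr_rle0 // pmulr_rle0.
apply: filter_forall => i; have := Vx i.
rewrite le_eqVlt => /predU1P[xi|xi]; near=> e; have e0 : 0 < e by [].
  have [k [k0 _ jE]] := jet_moment zs e0.
  rewrite dotDr xi gerDl jE !dotZr pmulr_rle0 // pmulr_rle0 //.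
  by near: e; apply: H.
rewrite dotDr addrC -lerBrDr ltW //; near: e.
by apply: near_jet_lt; rewrite subr_gt0.
Unshelve. all: by end_near. Qed.

Lemma conic_frame_npos zs : conic_frame zs <->
  orthonormal_list zs /\ forall i, dot (a i) x = b i ->
    \forall e \near 0^'+, dot (a i) (moment zs e) <= 0.
Proof.
elim/last_ind: zs => [|zs w IH].
  split=> [_|_]; last exact: conic_frame_nil.
  by split=> // i _; apply: nearW => e; rewrite orthogonal_lin.
split.
  case/conic_frame_rconsP => /IH[zo H] [ow cw] w1.
  split=> [|i xi]; first exact/orthonormal_rcons.
  by apply/moment_npos_rcons; split=> [|oi]; [exact: H|apply: cw].
case=> /orthonormal_rcons[zo ow w1] H.
have {}H i (xi : dot (a i) x = b i) :=
  (moment_npos_rcons zs w (a i)).1 (H i xi).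
apply/conic_frame_rconsP; split=> //.
  by apply/IH; split=> // i /H [].
by split=> // i [/H [_ +] oi]; apply.
Qed.

Lemma partial_jet_frameP zs :
  is_partial_jet_frame x halfspaces zs <-> conic_frame zs.
Proof.
rewrite conic_frame_npos -near_halfspaces_jet.
by split=> [[]|[]].
Qed.

(** For small [e], the inequalities that are not tight are strict along the jets
    of a frame. *)
Lemma near_slack zs : conic_frame zs ->
  \forall e \near 0^'+, forall i, ~ tight zs i ->
    dot (a i) (x + e *: jet zs e) < b i.
Proof.
move=> /conic_frame_npos[zo H]; apply: filter_forall => i.
have [ti|nti] := pselect (tight zs i); first by apply: nearW.
have := Vx i; rewrite le_eqVlt => /predU1P[xi|xi]; near=> e => _;
  have e0 : 0 < e by [].
  have [k [k0 _ jE]] := jet_moment zs e0.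
  rewrite dotDr xi gtrDl jE !dotZr pmulr_rlt0 // pmulr_rlt0 //.
  near: e; apply: moment_neg_near.
  by have /moment_npos[oi|//] := H i xi; case: nti.
rewrite dotDr addrC -ltrBrDr; near: e.
by apply: near_jet_lt; rewrite subr_gt0.
Unshelve. all: by end_near. Qed.

Lemma tangent_coneP y : tangent_cone x halfspaces y <->
  forall i, dot (a i) x = b i -> dot (a i) y <= 0.
Proof.
split=> [[c [z [c0 Vz ->]]] i xi|H].
  rewrite dotZr mulr_ge0_le0 //.
  by have := Vz i; rewrite dotDr xi gerDl.
have := @near_feasible _ _ _ a b (fun=> True) x y (fun i _ => Vx i).
case/(_ (fun i _ => H i))/near0_ex => t t0 Vt.
exists t^-1, (t *: y); rewrite invr_ge0 ltW //; split=> //.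
  by move=> i; apply: Vt.
by rewrite scalerA mulVf ?scale1r // gt_eqF.
Qed.

Lemma iterated_tangent_coneE zs : conic_frame zs ->
  iterated_tangent_cone x halfspaces zs = frame_cone zs.
Proof.
move=> f; have H := near_slack f; apply/seteqP; split=> v.
  case/near0_ex => e e0 [c [z [c0 [[w ow /addrI wz] /tangent_coneP Tz] ->]]].
  subst w; apply: frame_coneZ => //; split=> // i [xi oi].
  by have := Tz i xi; rewrite dotDr dot_jet // add0r.
move=> [ov cv]; rewrite /iterated_tangent_cone /=.
near=> e; have e0 : 0 < e by [].
have slack : forall i, ~ tight zs i -> dot (a i) (x + e *: jet zs e) < b i.
  by near: e.
have neg i : dot (a i) x = b i -> ~ tight zs i -> dot (a i) (jet zs e) < 0.
  by move=> xi /slack; rewrite dotDr xi gtrDl dotZr pmulr_rlt0.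
have : \forall t \near 0^'+, forall i, dot (a i) x = b i ->
    dot (a i) (jet zs e + t *: v) <= 0.
  apply: near_feasible => i xi;
    have [ti|/(neg i xi) lt] := pselect (tight zs i).
  - by rewrite dot_jet //; case: ti.
  - exact: ltW.
  - by move=> _; apply: cv.
  - by move=> E; rewrite E ltxx in lt.
case/near0_ex => t t0 Vt.
exists t^-1, (t *: v); rewrite invr_ge0 ltW //; split=> //.
  by split; [exists (t *: v) => //; apply: orthogonalZ|apply/tangent_coneP].
by rewrite scalerA mulVf ?scale1r // gt_eqF.
Unshelve. all: by end_near. Qed.

(** A frame whose cone is zero leads into the relative interior: every tight
    inequality is an equality on the whole polyhedron. *)
Lemma conic_frame_jet_frame zs : conic_frame zs -> frame_cone zs `<=` [set 0] ->
  is_jet_frame x halfspaces zs.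
Proof.
move=> f c0; have pf := (partial_jet_frameP zs).2 f; split=> //.
have o := conic_frame_orthonormal f.
have tightV i p : tight zs i -> halfspaces p -> dot (a i) p = b i.
  move=> [xi oi] Vp; have : frame_cone zs (reject zs (p - x)).
    by apply: frame_cone_reject => // j [xj _]; rewrite dotBr xj subr_le0.
  move/c0 => /= r0; have := dot_reject (p - x) oi.
  by rewrite r0 dot0r dotBr xi => /esym/eqP; rewrite subr_eq0 => /eqP.
case: pf => _ _ pf; near=> e; split; first by near: e.
have slack : forall i, ~ tight zs i -> dot (a i) (x + e *: jet zs e) < b i.
  by near: e; apply: near_slack.
suff : \forall z \near (x + e *: jet zs e), forall i,
    affine_hull halfspaces z -> dot (a i) z <= b i.
  by apply: filterS => z H hz i; apply: H.
have FF := @nbhs_filter 'rV[R]_d (x + e *: jet zs e).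
apply: (@filter_forall _ _ (fun i z =>
    affine_hull halfspaces z -> dot (a i) z <= b i) _ FF) => i.
have [ti|/slack lt] := pselect (tight zs i).
  apply: nearW => z [m [al [p [Vp al1 ->]]]]; rewrite dot_sumr.
  under eq_bigr do rewrite dotZr tightV //.
  by rewrite -mulr_suml al1 mul1r.
have := continuous_dot (u := a i) (x := x + e *: jet zs e).
move/cvgr_lt => /(_ _ lt); apply: filterS => z /ltW ? _ //.
Unshelve. all: by end_near. Qed.

(** A point beyond [y] on the line from [y + t *: v], as an affine combination
    of these two points. *)
Lemma line_extend y v s t : t != 0 ->
  y + s *: (- v) = (1 + s / t) *: y + - (s / t) *: (y + t *: v).
Proof. by move=> t0; apply/rowP => k; rewrite !mxE; field. Qed.

(** [frame_cone zs] is a linear subspace: the tight inequalities are equalities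
    on it. *)
Definition linear_cone zs : Prop :=
  forall v i, frame_cone zs v -> tight zs i -> dot (a i) v = 0.

(** From the relative interior points along the jet, one can move a short way
    within the polyhedron in every direction of the cone, hence also in the
    opposite direction. *)
Lemma jet_frame_linear zs :
  is_jet_frame x halfspaces zs -> linear_cone zs.
Proof.
move=> [/partial_jet_frameP f ri] v i cv ti.
apply/eqP; rewrite eq_le; case: (cv) => ov -> //=.
have [e e0 [slack [Vy hy]]] := near0_ex (filterI (near_slack f) ri).
set y := x + e *: jet zs e in slack Vy hy.
have : \forall t \near 0^'+, forall i, True -> dot (a i) (y + t *: v) <= b i.
  apply: near_feasible => [j _|j _ yj]; first exact: Vy.
  apply: cv.2; have [//|/slack] := pselect (tight zs j).
  by rewrite yj ltxx.
case/near0_ex => t t0 Vt.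
have cvy : (fun s : R => y + s *: (- v)) @ 0^'+ --> y.
  rewrite -[X in _ --> X]addr0 -(scale0r (- v)).
  apply: cvgD; first exact: cvg_cst.
  by apply: cvgZr_tmp; apply: cvg_at_right_filter; apply: cvg_id.
have := cvy _ hy; case/near0_ex => s s0 /=.
have hull : affine_hull halfspaces (y + s *: (- v)).
  exists 2%N, (fun i => if i == 0 then 1 + s / t else - (s / t)),
    (fun i => if i == 0 then y else y + t *: v); split.
  - by move=> j; case: ifP => _ // k; apply: Vt.
  - by rewrite !big_ord_recl big_ord0 /= addr0 addrK.
  - rewrite !big_ord_recl big_ord0 /= addr0.
    by rewrite -(@line_extend y v s t) // gt_eqF.
move=> /(_ hull)/(_ i); rewrite dotDr /y dotDr dotZr.
case: ti => -> oi; rewrite dot_jet // mulr0 addr0 gerDl dotZr dotNr.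
by rewrite pmulr_rle0 // oppr_le0.
Qed.

Lemma linear_cone_rcons zs w : frame_cone zs w -> linear_cone zs ->
  linear_cone (rcons zs w).
Proof.
move=> cw lin v i cv /tight_rcons[ti aw].
have [t t0 ct] := near0_ex (near_frame_cone cw cv).
have /eqP := lin _ i ct ti; rewrite dotDr aw add0r dotZr mulf_eq0 gt_eqF //=.
by move/eqP.
Qed.

(** A frame with a linear cone can be completed by vectors with nonnegative
    products with [nu], since the sign of each appended vector is free. *)
Lemma linear_frame_extension nu zs : conic_frame zs -> linear_cone zs ->
  exists ts, [/\ conic_frame (zs ++ ts), frame_cone (zs ++ ts) `<=` [set 0]
    & forall z, z \in ts -> 0 <= dot nu z].
Proof.
have [k] := ubnP (d.+1 - size zs); elim: k zs => [//|k IH] zs lek f lin.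
have [c0|] := pselect (frame_cone zs `<=` [set 0]).
  by exists [::]; rewrite cats0; split.
move/existsNP => [v /not_implyP[cv /eqP v0]].
have [] := frame_cone_normalize cv v0.
set w := (enorm v)^-1 *: v => cw w1.
have cNw : frame_cone zs (- w).
  split; first by apply: orthogonalN; case: cw.
  by move=> i ti; rewrite dotNr lin // oppr0.
have [u [cu u1 nu_u]] :
    exists u, [/\ frame_cone zs u, dot u u = 1 & 0 <= dot nu u].
  have [nuw|/ltW nuw] := leP 0 (dot nu w); first by exists w.
  by exists (- w); rewrite dotNl !dotNr opprK oppr_ge0.
have fu : conic_frame (rcons zs u) by apply/conic_frame_rconsP.
have := orthonormal_size (conic_frame_orthonormal fu).
rewrite size_rcons => ltd.
have [||ts [fts cts nuts]] := IH (rcons zs u) _ fu.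
- rewrite size_rcons subSS; move: lek; rewrite subSn; last exact: ltnW.
  by rewrite ltnS.
- exact: linear_cone_rcons.
exists (u :: ts); rewrite -cat_rcons; split=> // z.
by rewrite in_cons => /predU1P[->|/nuts].
Qed.

End Frames.

(** * The lexicographic order *)

Section Lex.
Variable R : realType.
Implicit Types p q r : seq R.

Lemma first_difference p q :
  (forall i : nat, p`_i = q`_i) \/
  exists2 k : nat, (forall i : nat, (i < k)%N -> p`_i = q`_i) & p`_k != q`_k.
Proof.
have [|/existsNP[i /eqP ne]] := pselect (forall i : nat, p`_i = q`_i).
  by left.
right; have [k ne' mink] := ex_minnP (ex_intro (fun i => p`_i != q`_i) i ne).
exists k => // j ltjk; apply/eqP; apply: contraTT ltjk => /mink.
by rewrite -leqNgt.
Qed.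

Lemma lex_ltP p q : lex_lt p q <->
  exists2 k : nat, (forall i : nat, (i < k)%N -> p`_i = q`_i) & p`_k < q`_k.
Proof.
split=> -[k eqk ltk]; exists k; rewrite ?subr_lt0 // in ltk *; move=> i /eqk.
  by move/eqP; rewrite subr_eq0 => /eqP.
by move=> ->; rewrite subrr.
Qed.

(** The lexicographic order extends the pointwise order of padded lists. *)
Lemma lex_le_pointwise p q : (forall i : nat, p`_i <= q`_i) -> lex_le p q.
Proof.
move=> le; have [|[k eqk nek]] := first_difference p q; first by right.
by left; apply/lex_ltP; exists k; rewrite // lt_neqAle nek le.
Qed.

Lemma lex_le_refl p : lex_le p p.
Proof. by right. Qed.

Lemma lex_le_total p q : lex_le p q \/ lex_le q p.
Proof.
have [|[k eqk nek]] := first_difference p q; first by left; right.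
have [lt|lt|E] := ltgtP (p`_k) (q`_k); last by rewrite E eqxx in nek.
  by left; left; apply/lex_ltP; exists k.
by right; left; apply/lex_ltP; exists k => // i /eqk.
Qed.

Lemma lex_le_trans p q r : lex_le p q -> lex_le q r -> lex_le p r.
Proof.
case=> [/lex_ltP[k eqk ltk]|eqpq] [/lex_ltP[l eql ltl]|eqqr].
- left; apply/lex_ltP; exists (minn k l).
    by move=> i; rewrite leq_min => /andP[/eqk-> /eql->].
  have [lt|lt|E] := ltngtP k l.
  + by rewrite -eql.
  + by rewrite eqk.
  + by rewrite -E in ltl; apply: lt_trans ltl.
- by left; apply/lex_ltP; exists k => [i /eqk->//|]; rewrite -eqqr.
- by left; apply/lex_ltP; exists l => [i /eql<-//|]; rewrite eqpq.
- by right=> i; rewrite eqpq eqqr.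
Qed.

Lemma lex_lt_cat p q r (c c' : R) :
  c < c' -> lex_lt (p ++ c :: q) (p ++ c' :: r).
Proof.
move=> lt; apply/lex_ltP; exists (size p) => [i li|].
  by rewrite !nth_cat li.
by rewrite !nth_cat ltnn subnn.
Qed.

Lemma lex_minimum (T : eqType) (f : T -> seq R) (s : seq T) (t0 : T) :
  t0 \in s -> exists2 t, t \in s & forall t', t' \in s -> lex_le (f t) (f t').
Proof.
elim: s t0 => [//|t s IH] t0 _; case: s IH => [_|t1 s IH].
  exists t; rewrite ?mem_head // => t'; rewrite inE => /eqP->.
  exact: lex_le_refl.
have [m ms minm] := IH t1 (mem_head _ _).
have [le|le] := lex_le_total (f t) (f m).
  exists t; first exact: mem_head.
  move=> t'; rewrite in_cons => /predU1P[->|/minm]; first exact: lex_le_refl.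
  exact: lex_le_trans.
exists m; first by rewrite in_cons ms orbT.
by move=> t'; rewrite in_cons => /predU1P[->//|/minm].
Qed.

Lemma nth_angle_seq d (nu : 'rV[R]_d) zs i :
  (angle_seq nu zs)`_i = - dot nu zs`_i.
Proof.
have [lti|lei] := ltnP i (size zs); first by rewrite (nth_map 0).
by rewrite !nth_default ?size_map // dot0r oppr0.
Qed.

Lemma angle_seq_cat d (nu : 'rV[R]_d) zs ts :
  angle_seq nu (zs ++ ts) = angle_seq nu zs ++ angle_seq nu ts.
Proof. exact: map_cat. Qed.

Lemma angle_seq_cat_le d (nu : 'rV[R]_d) zs ts :
  (forall z, z \in ts -> 0 <= dot nu z) ->
  lex_le (angle_seq nu (zs ++ ts)) (angle_seq nu zs).
Proof.
move=> ts0; apply: lex_le_pointwise => i; rewrite !nth_angle_seq lerN2 nth_cat.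
case: ltnP => [//|le]; rewrite [zs`_i]nth_default // dot0r.
have [lt|ge] := ltnP (i - size zs) (size ts); first exact/ts0/mem_nth.
by rewrite nth_default // dot0r.
Qed.

End Lex.

(** * Directions that minimize the angle *)

Section Optimal.
Variables (R : realType) (d n : nat).
Variables (a : 'I_n -> 'rV[R]_d) (b : 'I_n -> R) (x nu : 'rV[R]_d).
Implicit Types (u v w y : 'rV[R]_d) (zs : seq 'rV[R]_d) (c e g t s : R).

Local Notation cone := (frame_cone a b x).
Local Notation frame := (conic_frame a b x).
Local Notation tight := (tight a b x).

(** The invariant of the procedure: [nu] is nonpositive on the cone, so that one
    of the two kinds of steps applies as long as the cone is nonzero. *)
Definition nonpositive_on zs : Prop := forall v, cone zs v -> dot nu v <= 0.

(** The situation of the step that appends unit vectors along rays. *)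
Definition negative_on zs : Prop :=
  forall v, cone zs v -> v != 0 -> dot nu v < 0.

(** [w] is a unit vector of the cone that minimizes the angle with [nu] among
    all nonzero vectors of the cone, not only among those along rays. The
    homogeneous form of the inequality avoids division by norms. *)
Definition optimal zs w : Prop :=
  [/\ cone zs w, dot w w = 1
    & forall v, cone zs v -> dot nu v <= dot nu w * enorm v].

Lemma optimal_le_unit zs w v :
  optimal zs w -> cone zs v -> dot v v = 1 -> dot nu v <= dot nu w.
Proof.
by case=> _ _ opt cv v1; rewrite -[leRHS]mulr1 -((enorm_eq1 v).2 v1) opt.
Qed.

Lemma optimal_of_orthogonal zs w : nonpositive_on zs ->
  cone zs w -> dot w w = 1 -> dot nu w = 0 -> optimal zs w.
Proof. by move=> np cw w1 nuw; split=> // v /np; rewrite nuw mul0r. Qed.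

Lemma enorm_add_orthogonal w v t : dot w w = 1 -> dot w v = 0 ->
  enorm (w + t *: v) = Num.sqrt (1 + t ^+ 2 * dot v v).
Proof.
move=> w1 wv; congr Num.sqrt.
rewrite dotDr !dotDl !dotZr !dotZl w1 wv (dotC v) wv.
by rewrite !mulr0 addr0 add0r mulrA -expr2.
Qed.

(** A direction [v] of the next cone is orthogonal to [w], so [w + t *: v] has
    norm at least 1; as [dot nu w <= 0], optimality of [w] bounds
    [dot nu (w + t *: v)] by [dot nu w]. *)
Lemma nonpositive_rcons zs w : nonpositive_on zs -> optimal zs w ->
  nonpositive_on (rcons zs w).
Proof.
move=> np [cw w1 opt] v cv; have [/orthogonal_rcons[_ wv] _] := cv.
have [t t0 /opt] := near0_ex (near_frame_cone cw cv).
rewrite dotDr dotZr enorm_add_orthogonal // => le.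
rewrite -(pmulr_rle0 _ t0) -(lerD2l (dot nu w)) addr0.
apply: le_trans le _; apply: ler_neMr; first exact: np.
by rewrite -[leLHS]sqrtr1 ler_wsqrtr // lerDl mulr_ge0 ?sqr_ge0 ?dot_ge0.
Qed.

Lemma closed_unit_cone zs : closed [set v | cone zs v /\ dot v v = 1].
Proof.
have pre (f : 'rV[R]_d -> R) (A : set R) :
  continuous f -> closed A -> closed (f @^-1` A).
  by move=> /continuous_closedP; apply.
have c1 u : closed (dot u @^-1` [set 0]).
  by apply: pre; [exact: continuous_dot|exact: closed_eq].
have c2 u : closed (dot u @^-1` [set r | r <= 0]).
  by apply: pre; [exact: continuous_dot|exact: closed_le].
have c3 : closed ((fun v : 'rV[R]_d => dot v v) @^-1` [set 1]).
  apply: pre; last exact: closed_eq.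
  apply: continuous_big => [|i _ y]; first exact: add_continuous.
  by apply: cvgM; [exact: nbhs_filter|exact: coord_continuous..].
apply: closedI; last exact: c3.
apply: closedI.
  by apply: (@closed_bigI _ _ [set i | (i < size zs)%N]
    (fun i => dot zs`_i @^-1` [set 0])).
by apply: (@closed_bigI _ _ [set i | tight zs i]
  (fun i => dot (a i) @^-1` [set r | r <= 0])).
Qed.

Lemma compact_unit_cone zs : compact [set v | cone zs v /\ dot v v = 1].
Proof.
apply: bounded_closed_compact; last exact: closed_unit_cone.
exists 1; split=> [|M M1 v [_ v1]]; first exact: num_real.
apply: le_trans (ltW M1); change (mx_norm v <= 1).
have [->|/mx_norm_neq0[ij ->]] := eqVneq (mx_norm v) 0; first exact: ler01.
rewrite (ord1 ij.1) -(@ler_pXn2r _ 2) ?nnegrE // expr1n.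
by rewrite real_normK ?num_real // -v1 dot_entry.
Qed.

Lemma exists_optimal zs v : cone zs v -> v != 0 -> exists w, optimal zs w.
Proof.
move=> cv v0; have := @EVT_max_rV R _ (dot nu) _ _ (@compact_unit_cone zs).
case=> [||w]; first by eexists; apply: frame_cone_normalize cv v0.
  by apply: continuous_subspaceT; apply: continuous_dot.
rewrite inE => -[cw w1] max; exists w; split=> // u cu.
have [->|u0] := eqVneq u 0; first by rewrite dot0r /enorm dot0r sqrtr0 mulr0.
have := max ((enorm u)^-1 *: u); rewrite inE.
move=> /(_ (frame_cone_normalize cu u0)).
by rewrite dotZr mulrC ler_pdivrMr // enorm_gt0.
Qed.

(** An optimal vector spans the minimal face that contains it. Otherwise one
    could move from [w] within the face in two opposite directions orthogonal
    to [w]; this strictly increases the norm of [w], so optimality would make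
    the products of both directions with [nu] negative. *)
Lemma optimal_face zs w y : negative_on zs -> optimal zs w -> cone zs y ->
  (forall i, tight zs i -> dot (a i) w = 0 -> dot (a i) y = 0) ->
  y = dot w y *: w.
Proof.
move=> neg [cw w1 opt] [oy cy] wy; apply/eqP; rewrite -subr_eq0.
set v := y - _; apply/negPn/negP => v0.
have wv : dot w v = 0 by rewrite dotBr dotZr w1 mulr1 subrr.
have ov : orthogonal_list zs v.
  by apply: orthogonalD => //; apply/orthogonalN/orthogonalZ; case: cw.
have av i : tight zs i -> dot (a i) w = 0 -> dot (a i) v = 0.
  by move=> ti aw; rewrite dotBr dotZr aw mulr0 subr0 wy.
have nuw := neg w cw (unit_neq0 w1).
have neg_v u : orthogonal_list zs u -> dot w u = 0 -> u != 0 ->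
    (forall i, tight zs i -> dot (a i) w = 0 -> dot (a i) u = 0) ->
    dot nu u < 0.
  move=> ou wu u0 au.
  have : \forall t \near 0^'+, forall i, tight zs i ->
      dot (a i) (w + t *: u) <= 0.
    by apply: near_feasible => i ti; [apply: cw.2|move/(au i ti)->].
  case/near0_ex => t t0 cwu.
  have /opt : cone zs (w + t *: u).
    by split=> //; apply: orthogonalD; [case: cw|apply: orthogonalZ].
  rewrite dotDr dotZr enorm_add_orthogonal // => le.
  rewrite -(pmulr_rlt0 _ t0) -(ltrD2l (dot nu w)) addr0.
  apply: (le_lt_trans le); rewrite gtr_nMr // -[ltLHS]sqrtr1 ltr_sqrt.
    by rewrite ltrDl mulr_gt0 ?exprn_gt0 ?dot_gt0.
  by rewrite ltr_pwDl // mulr_ge0 ?sqr_ge0 ?dot_ge0.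
have := neg_v v ov wv v0 av; rewrite ltNge -oppr_le0 -dotNr ltW //.
apply: neg_v; rewrite ?oppr_eq0 //; first exact: orthogonalN.
  by rewrite dotNr wv oppr0.
by move=> i ti aw; rewrite dotNr av ?oppr0.
Qed.

(** The ray is the minimal face that contains [w], cut out by the sum of the
    tight normal vectors that are orthogonal to [w]. *)
Lemma optimal_ray zs w : negative_on zs -> optimal zs w ->
  exists F, ray_unit_vector F (cone zs) w.
Proof.
move=> neg opt; have [cw w1 _] := opt.
pose P i := `[< tight zs i /\ dot (a i) w = 0 >].
pose u := \sum_(i | P i) a i.
have uE y : dot u y = \sum_(i | P i) dot (a i) y.
  by rewrite dotC dot_sumr; apply: eq_bigr => i _; rewrite dotC.
have uw : dot u w = 0 by rewrite uE big1 // => i /asboolP[].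
have u_le y : cone zs y -> dot u y <= 0.
  by move=> [_ cy]; rewrite uE sumr_le0 // => i /asboolP[/cy].
pose F := [set y | cone zs y /\ dot u y = dot u w].
have Fw y : F y -> y = dot w y *: w.
  move=> [cy]; rewrite uw uE => /eqP uy.
  apply: (optimal_face neg opt) => // i ti aw.
  have Pi : P i by apply/asboolP.
  move: uy; rewrite -oppr_eq0 -sumrN => /eqP/psumr_eq0P H.
  apply/eqP; rewrite -oppr_eq0; apply/eqP; apply: H => // j /asboolP[[tj oj] _].
  by rewrite oppr_ge0; apply: cy.2.
exists F; split; last exact/enorm_eq1; last by split.
split; first by exists u, w; do 2?split=> //; move=> y /u_le; rewrite uw.
exists 0, w; split; first exact: unit_neq0.
apply/seteqP; split=> [y [m [al [p [Fp _ ->]]]]|y [t ->]].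
  exists (\sum_i al i * dot w (p i)); rewrite add0r scaler_suml.
  by apply: eq_bigr => i _; rewrite {1}(Fw _ (Fp i)) scalerA.
exists 2%N, (fun i => if i == 0 then 1 - t else t),
  (fun i => if i == 0 then 0 else w).
rewrite !big_ord_recl !big_ord0 /= scaler0 !addr0 subrK; split=> // i.
case: ifP => _; last by split.
by split; [exact: frame_cone0|rewrite uw dot0r].
Qed.

Lemma ray_unit_cone F (C : set 'rV[R]_d) w :
  ray_unit_vector F C w -> C w /\ dot w w = 1.
Proof. by move=> [[[u [y [_ ->]]] _] [Cw _] /enorm_eq1]. Qed.

Lemma le_angle w w' : nu != 0 -> dot w w = 1 -> dot w' w' = 1 ->
  (angle nu w <= angle nu w') = (dot nu w' <= dot nu w).
Proof.
move=> nu0 w1 w1'; have nu_gt0 : 0 < enorm nu by rewrite enorm_gt0.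
have itv v : dot v v = 1 -> -1 <= dot nu v / (enorm nu * enorm v) <= 1.
  move=> v1; rewrite ((enorm_eq1 v).2 v1) mulr1 -ler_norml normrM normfV.
  rewrite (gtr0_norm nu_gt0) ler_pdivrMr // mul1r.
  exact: le_dot_unit.
have [a1 c1] := acos_def (itv w w1); have [a2 c2] := acos_def (itv w' w1').
rewrite leNgt [RHS]leNgt -ltr_cos ?in_itv // c1 c2.
rewrite ((enorm_eq1 w).2 w1) ((enorm_eq1 w').2 w1') !mulr1.
by rewrite ltr_pM2r // invr_gt0.
Qed.

Lemma negative_neq0 zs w :
  negative_on zs -> cone zs w -> dot w w = 1 -> nu != 0.
Proof.
move=> neg cw w1; apply: contraTneq (neg w cw (unit_neq0 w1)) => ->.
by rewrite dot0l ltxx.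
Qed.

(** Minimizing the angle among the rays is minimizing it on the whole cone. *)
Lemma min_angle_ray_optimal zs w : negative_on zs ->
  min_angle_ray_unit_vector nu (cone zs) w <-> optimal zs w.
Proof.
move=> neg; split=> [[F /ray_unit_cone[cw w1] min]|opt].
  have [w0 opt] := exists_optimal cw (unit_neq0 w1).
  have [F0 ray0] := optimal_ray neg opt; have := min _ _ ray0.
  have [cw0 w01 opt0] := opt; have nu0 := negative_neq0 neg cw w1.
  rewrite le_angle // => le; split=> // v /opt0/le_trans; apply.
  by rewrite ler_wpM2r // enorm_ge0.
have [cw w1 _] := opt; have [F ray] := optimal_ray neg opt.
exists F => // F' w' /ray_unit_cone[cw' w1'].
rewrite le_angle // ?(negative_neq0 neg cw w1) //.
exact: optimal_le_unit opt cw' w1'.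
Qed.

(** By [optimal_face], an optimal vector is determined by the set of those
    inequalities that are equalities at it. *)
Lemma finite_optimal zs : negative_on zs -> finite_set [set w | optimal zs w].
Proof.
move=> neg; pose f w := [set i : 'I_n | `[< dot (a i) w = 0 >]]%SET.
have inj w w' : optimal zs w -> optimal zs w' -> f w = f w' -> w = w'.
  move=> opt opt' /setP ff; have [cw w1 _] := opt; have [cw' w1' _] := opt'.
  have E : w' = dot w w' *: w.
    apply: (optimal_face neg opt cw') => i ti /asboolP aw.
    by have := ff i; rewrite !inE aw => /esym/asboolP.
  have nuE : dot nu w' = dot nu w.
    by apply/eqP; rewrite eq_le !(optimal_le_unit opt, optimal_le_unit opt').
  move: nuE; rewrite {1}E dotZr => /eqP.
  rewrite -subr_eq0 -{2}[dot nu w]mul1r -mulrBl mulf_eq0 subr_eq0.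
  rewrite (lt_eqF (neg w cw (unit_neq0 w1))) orbF => /eqP c1.
  by rewrite E c1 scale1r.
pose g (s : {set 'I_n}) := xget 0 [set w | optimal zs w /\ f w = s].
apply: (@sub_finite_set _ _ (range g)); last first.
  by apply: finite_image; apply: finite_finset.
move=> w opt; exists (f w) => //; rewrite /g; case: xgetP => [w' _ [opt' ff]|].
  exact: inj.
by move=> /(_ w)[]; split.
Qed.

End Optimal.

(** * The greedy procedure *)

Section Greedy.
Variables (R : realType) (d n : nat).
Variables (a : 'I_n -> 'rV[R]_d) (b : 'I_n -> R) (x nu : 'rV[R]_d).
Variable sel : seq 'rV[R]_d -> 'rV[R]_d.
Implicit Types (u v w y : 'rV[R]_d) (zs : seq 'rV[R]_d) (c e g t s : R).

Local Notation V := (halfspaces a b).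
Local Notation cone := (frame_cone a b x).
Local Notation frame := (conic_frame a b x).
Local Notation tight := (tight a b x).
Local Notation nonpositive_on := (nonpositive_on a b x nu).
Local Notation negative_on := (negative_on a b x nu).
Local Notation optimal := (optimal a b x nu).
Local Notation built := (constructed nu x V sel).
Local Notation out := (output nu x V sel).

(** [nu] vanishes at no nonzero vector of the cone. *)
Definition null_trivial zs : Prop :=
  forall v, cone zs v -> dot nu v = 0 -> v = 0.

(** [u] is orthogonal to [zs] and to all vectors of the cone on which [nu]
    vanishes. If [nu] is nonpositive on the cone, these vectors form a face. *)
Definition null_orthogonal zs u : Prop :=
  orthogonal_list zs u /\ forall v, cone zs v -> dot nu v = 0 -> dot u v = 0.

(** The spans of [zs] and [zs'], each enlarged by the vectors of the respective
    cone on which [nu] vanishes, agree. The spans are compared through their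
    orthogonal complements. *)
Definition equivalent zs zs' : Prop :=
  forall u, null_orthogonal zs u <-> null_orthogonal zs' u.

(** Appending a vector on which [nu] vanishes does not change the enlarged span:
    the choice made in such a step is immaterial. *)
Lemma null_orthogonal_rcons zs w u : cone zs w -> dot w w = 1 -> dot nu w = 0 ->
  null_orthogonal (rcons zs w) u <-> null_orthogonal zs u.
Proof.
move=> cw w1 nuw; split=> [[/orthogonal_rcons[ou wu] nu_u]|[ou nu_u]].
  split=> // v [ov cv] nuv; have : dot u (v - dot w v *: w) = 0.
    apply: nu_u; last by rewrite dotBr dotZr nuw nuv mulr0 subr0.
    split=> [|i /tight_rcons[ti aw]]; last first.
      by rewrite dotBr dotZr aw mulr0 subr0 cv.
    apply/orthogonal_rcons; split; last by rewrite dotBr dotZr w1 mulr1 subrr.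
    by apply: orthogonalD => //; apply/orthogonalN/orthogonalZ; case: cw.
  by rewrite dotBr dotZr (dotC u w) wu mulr0 subr0.
have uw := nu_u w cw nuw.
split=> [|v cv nuv]; first by apply/orthogonal_rcons; rewrite dotC.
have [t t0 /nu_u] := near0_ex (near_frame_cone cw cv).
rewrite !dotDr !dotZr nuw nuv uw mulr0 addr0 add0r => /(_ erefl)/eqP.
by rewrite mulf_eq0 gt_eqF //= => /eqP.
Qed.

(** If [nu] vanishes only at 0 on the cone of [zs], the enlarged span of [zs]
    has dimension at most [size zs]. Then so has the enlarged span of the
    orthonormal list [zs'] of the same size, which leaves no room for a nonzero
    vector of the cone of [zs'] on which [nu] vanishes. *)
Lemma equivalent_null_trivial zs zs' : size zs = size zs' ->
  orthonormal_list zs' -> equivalent zs zs' -> null_trivial zs ->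
  null_trivial zs'.
Proof.
move=> sz on' eqv triv v cv nuv; apply/eqP/negPn/negP => v0.
have [cw w1] := frame_cone_normalize cv v0.
set w := (enorm v)^-1 *: v in cw w1.
have nuw : dot nu w = 0 by rewrite dotZr nuv mulr0.
have onw : orthonormal_list (rcons zs' w) by apply/orthonormal_rcons; case: cw.
have [|c [y0 oy]] := @exists_orthogonal_lin _ _ zs _ _ onw.
  by rewrite size_rcons sz.
set y := lin _ c in y0 oy.
have [oy' yw] : null_orthogonal zs' y.
  apply/eqv; split=> // u cu nuu.
  by rewrite (triv u cu nuu) dot0r.
have : orthogonal_list (rcons zs' w) y.
  by apply/orthogonal_rcons; rewrite dotC yw.
by move/(orthogonal_lin c)/eqP; rewrite dot_eq0 (negbTE y0).
Qed.

Lemma equivalent_sym zs zs' : equivalent zs zs' -> equivalent zs' zs.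
Proof. by move=> eqv u; split=> /eqv. Qed.

Lemma equivalent_orthogonal zs zs' : equivalent zs zs' ->
  null_trivial zs -> null_trivial zs' ->
  forall u, orthogonal_list zs u <-> orthogonal_list zs' u.
Proof.
move=> eqv triv triv' u.
split=> ou;
  [have [//] : null_orthogonal zs' u|have [//] : null_orthogonal zs u].
  by apply/eqv; split=> // v cv nuv; rewrite (triv v) // dot0r.
by apply/eqv; split=> // v cv nuv; rewrite (triv' v) // dot0r.
Qed.

Lemma orthogonal_frame_cone zs zs' :
  (forall u, orthogonal_list zs u <-> orthogonal_list zs' u) ->
  cone zs = cone zs'.
Proof.
move=> o; apply/seteqP; split=> v [ov cv]; split=> [|i [xi oi]]; try exact/o.
  by apply: cv; split=> //; apply/o.
by apply: cv; split=> //; apply/o.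
Qed.

Lemma orthogonal_equivalent zs zs' :
  (forall u, orthogonal_list zs u <-> orthogonal_list zs' u) ->
  equivalent zs zs'.
Proof.
by move=> o u; rewrite /null_orthogonal (orthogonal_frame_cone o) o.
Qed.

Lemma equivalent_rcons zs zs' w w' :
  equivalent zs zs' -> optimal zs w -> optimal zs' w' ->
  dot nu w = 0 -> dot nu w' = 0 -> equivalent (rcons zs w) (rcons zs' w').
Proof.
move=> eqv [cw w1 _] [cw' w1' _] nuw nuw' u.
by rewrite !null_orthogonal_rcons.
Qed.


Hypothesis Vx : V x.
Hypothesis suppV : forall y, V y -> dot nu y <= dot nu x.
Hypothesis selP : valid_selection nu x V sel.

Lemma nonpositive_nil : nonpositive_on [::].
Proof.
move=> v [_ cv].
have := @near_feasible _ _ _ a b (fun=> True) x v (fun i _ => Vx i).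
case/(_ (fun i _ xi => cv i (conj xi (orthogonal_nil _))))/near0_ex => t t0 Vt.
have /suppV : V (x + t *: v) by move=> i; apply: Vt.
by rewrite dotDr dotZr gerDl pmulr_rle0.
Qed.

Lemma null_trivial_negative zs :
  nonpositive_on zs -> null_trivial zs -> negative_on zs.
Proof.
move=> np triv v cv v0; rewrite lt_neqAle np // andbT.
by apply: contraNneq v0 => /(triv v cv)->.
Qed.

Lemma has_orthogonal_directionP zs : frame zs ->
  has_orthogonal_direction nu x V zs <-> ~ null_trivial zs.
Proof.
move=> f; rewrite /has_orthogonal_direction iterated_tangent_coneE //; split.
  by move=> [w cw [/eqP w0 nuw]] triv; apply/w0/triv.
move/existsNP => [v /not_implyP[cv /not_implyP[nuv /eqP v0]]].
by exists v.
Qed.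

Lemma sel_optimal zs : frame zs -> nonpositive_on zs ->
  has_orthogonal_direction nu x V zs ->
  optimal zs (sel zs) /\ dot nu (sel zs) = 0.
Proof.
move=> f np; have pf := (partial_jet_frameP Vx zs).2 f.
case/(selP pf); rewrite iterated_tangent_coneE // => cs /enorm_eq1 s1 nus.
by split=> //; apply: optimal_of_orthogonal.
Qed.

Lemma frame_step zs w : frame zs /\ nonpositive_on zs -> optimal zs w ->
  frame (rcons zs w) /\ nonpositive_on (rcons zs w).
Proof.
move=> [f np] opt; split; last exact: nonpositive_rcons.
by apply/conic_frame_rconsP; case: opt.
Qed.

Lemma built_frame zs : built zs -> frame zs /\ nonpositive_on zs.
Proof.
elim=> [|zs' _ IH _ ho|zs' w _ IH _ + min].
- by split; [exact: conic_frame_nil|exact: nonpositive_nil].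
- by apply: frame_step => //; case: IH => f np; case: (sel_optimal f np ho).
- move: min; rewrite /all_directions_negative (iterated_tangent_coneE Vx IH.1).
  by move=> min neg; apply: frame_step => //; apply/min_angle_ray_optimal.
Qed.

Lemma cone_neq0 zs v : cone zs v -> v != 0 -> cone zs <> [set 0].
Proof. by move=> cv /eqP v0 E; move: cv; rewrite E. Qed.

Lemma built_orthogonal zs : built zs -> ~ null_trivial zs ->
  [/\ built (rcons zs (sel zs)), optimal zs (sel zs) & dot nu (sel zs) = 0].
Proof.
move=> bz ntriv; have [f np] := built_frame bz.
have ho := (has_orthogonal_directionP f).2 ntriv.
have [opt nus] := sel_optimal f np ho; split=> //.
apply: constructed_orthogonal => //; rewrite iterated_tangent_coneE //.
by have [cs /unit_neq0 s0 _] := opt; apply: cone_neq0 s0.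
Qed.

Lemma built_ray zs w : built zs -> null_trivial zs -> optimal zs w ->
  built (rcons zs w).
Proof.
move=> bz triv opt; have [f np] := built_frame bz.
have neg := null_trivial_negative np triv.
have E := iterated_tangent_coneE Vx f.
apply: constructed_ray => //; rewrite /all_directions_negative ?E //.
  by have [cs /unit_neq0 s0 _] := opt; apply: cone_neq0 s0.
exact/min_angle_ray_optimal.
Qed.

Lemma built_next zs : built zs -> cone zs <> [set 0] ->
  exists w, built (rcons zs w).
Proof.
move=> bz c0; have [triv|ntriv] := pselect (null_trivial zs); last first.
  by exists (sel zs); case: (built_orthogonal bz ntriv).
have [v cv v0] : exists2 v, cone zs v & v != 0.
  apply/not_exists2P => H; apply: c0; apply/seteqP; split=> v.
    by move=> cv; have [//|/negP/negPn/eqP] := H v.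
  by move=> ->; apply: frame_cone0.
have [w opt] := exists_optimal nu cv v0.
by exists w; apply: built_ray.
Qed.

Lemma output_cone zs : out zs <-> built zs /\ cone zs = [set 0].
Proof.
split=> -[bz]; have [f _] := built_frame bz;
  have E := iterated_tangent_coneE Vx f.
  by rewrite E.
by rewrite /output /= E.
Qed.

Lemma built_size zs : built zs -> (size zs <= d)%N.
Proof.
by move=> /built_frame[f _]; apply/orthonormal_size/conic_frame_orthonormal/f.
Qed.

Lemma built_output zs : built zs -> exists ts, out (zs ++ ts).
Proof.
have [k] := ubnP (d.+1 - size zs); elim: k zs => [//|k IH] zs lek bz.
have [c0|c0] := pselect (cone zs = [set 0]).
  by exists [::]; rewrite cats0; apply/output_cone.
have [w bw] := built_next bz c0.
have := built_size bw; rewrite size_rcons => ltd.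
have [|ts out_ts] := IH (rcons zs w) _ bw.
  by rewrite size_rcons subSS; move: lek; rewrite subSn ?ltnS // ltnW.
by exists (w :: ts); rewrite -cat_rcons.
Qed.

Lemma finite_built : finite_set [set zs | built zs].
Proof.
have fin k : finite_set [set zs | built zs /\ size zs = k].
  elim: k => [|k IH].
    by apply: (@sub_finite_set _ _ [set [::]]) => // zs [_ /size0nil].
  pose next zs := [set rcons zs w | w in
    [set sel zs] `|` [set w | negative_on zs /\ optimal zs w]].
  apply: (@sub_finite_set _ _
      (\bigcup_(zs in [set zs | built zs /\ size zs = k]) next zs)).
    move=> zs [bz]; case: bz => [//|zs' bz _ _|zs' w bz _ neg min].
      rewrite size_rcons => -[sz]; exists zs' => //.
      by exists (sel zs') => //; left.
    rewrite size_rcons => -[sz]; exists zs' => //; exists w => //; right.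
    have [f _] := built_frame bz; have E := iterated_tangent_coneE Vx f.
    rewrite /all_directions_negative E in neg min.
    by split=> //; apply/(min_angle_ray_optimal _ neg).
  apply: bigcup_finite => // zs _; apply: finite_image.
  rewrite finite_setU; split=> //.
  have [neg|nneg] := pselect (negative_on zs).
    by apply: sub_finite_set (finite_optimal neg) => w [].
  by apply: sub_finite_set (finite_set0 _) => w [].
apply: (@sub_finite_set _ _
    (\bigcup_(k < d.+1) [set zs | built zs /\ size zs = k])).
  by move=> zs bz; exists (size zs) => //=; rewrite ltnS; apply: built_size.
by apply: bigcup_finite => // k _; apply: fin.
Qed.

(** The procedure performs at least as well as any frame [zs' ++ ts] with zero
    cone. Here [zs] is a constructed frame that has kept level with the initial
    part [zs']. Either the next vector of the competitor is not optimal and the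
    procedure wins with an optimal one, or the procedure keeps level, by
    following the competitor if it appends a unit vector along a ray. *)
Lemma built_competitive ts zs zs' : built zs ->
  frame (zs' ++ ts) -> cone (zs' ++ ts) `<=` [set 0] -> nonpositive_on zs' ->
  size zs = size zs' -> equivalent zs zs' ->
  angle_seq nu zs = angle_seq nu zs' ->
  exists2 us, out us & lex_le (angle_seq nu us) (angle_seq nu (zs' ++ ts)).
Proof.
elim: ts zs zs' => [|w' ts IH] zs zs' bz f' c0 np' sz eqv ang.
  rewrite cats0 in f' c0 *.
  have triv' : null_trivial zs' by move=> v /c0.
  have triv : null_trivial zs.
    apply: (equivalent_null_trivial (esym sz)) (equivalent_sym eqv) triv'.
    exact: conic_frame_orthonormal (built_frame bz).1.
  have E := orthogonal_frame_cone (equivalent_orthogonal eqv triv triv').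
  exists zs; last by rewrite ang; apply: lex_le_refl.
  apply/output_cone; split=> //; rewrite E; apply/seteqP; split=> // v ->.
  exact: frame_cone0.
have onz := conic_frame_orthonormal (built_frame bz).1.
rewrite -cat_rcons in f' c0 *.
have f'w : frame (rcons zs' w').
  exact: conic_frame_prefix f'.
have [f'z cw' w1'] := (conic_frame_rconsP _ _ _ _ _).1 f'w.
(* A larger product with [nu] at the next vector decides the comparison. *)
have win w : built (rcons zs w) -> dot nu w' < dot nu w ->
    exists2 us, out us &
      lex_le (angle_seq nu us) (angle_seq nu (rcons zs' w' ++ ts)).
  move=> bw lt; have [us out_us] := built_output bw.
  exists (rcons zs w ++ us) => //; left.
  rewrite !cat_rcons !angle_seq_cat ang /=.
  by apply: lex_lt_cat; rewrite ltrN2.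
(* With equal products, the comparison goes on by induction. *)
have follow w : built (rcons zs w) -> optimal zs' w' -> dot nu w = dot nu w' ->
    equivalent (rcons zs w) (rcons zs' w') ->
    exists2 us, out us &
      lex_le (angle_seq nu us) (angle_seq nu (rcons zs' w' ++ ts)).
  move=> bw opt' nuww eqvw; apply: (IH _ _ bw) => //.
  - exact: nonpositive_rcons opt'.
  - by rewrite !size_rcons sz.
  - by rewrite /angle_seq !map_rcons nuww -/(angle_seq nu zs) ang.
have [triv|ntriv] := pselect (null_trivial zs); last first.
  have [bs opt nus] := built_orthogonal bz ntriv.
  have [lt|] := ltP (dot nu w') 0; first by apply: win bs _; rewrite nus.
  move=> ge; have nuw' : dot nu w' = 0 by apply/eqP; rewrite eq_le np'.
  have opt' := optimal_of_orthogonal np' cw' w1' nuw'.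
  apply: (follow _ bs opt'); first by rewrite nus.
  exact: equivalent_rcons eqv opt opt' nus nuw'.
have on' := conic_frame_orthonormal f'z.
have triv' := equivalent_null_trivial sz on' eqv triv.
have o := equivalent_orthogonal eqv triv triv'.
have E := orthogonal_frame_cone o.
have [w opt] := exists_optimal nu cw' (unit_neq0 w1').
have optz : optimal zs w by rewrite /optimal E.
have [lt|ge] := ltP (dot nu w') (dot nu w).
  exact: win (built_ray bz triv optz) lt.
have opt' : optimal zs' w'.
  have [_ _ maxw] := opt; split=> // v /maxw/le_trans; apply.
  by rewrite ler_wpM2r ?enorm_ge0.
have optz' : optimal zs w' by rewrite /optimal E.
apply: follow (built_ray bz triv optz') opt' erefl _.
apply: orthogonal_equivalent => u.
by rewrite !orthogonal_rcons o.
Qed.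

End Greedy.

Theorem theorem4p11 (R : realType) (d : nat) (V : set 'rV[R]_d)
    (x nu : 'rV[R]_d) (sel : seq 'rV[R]_d -> 'rV[R]_d)
    (polyV : is_polyhedron V)
    (suppV : is_outer_support_vector nu V x)
    (selP : valid_selection nu x V sel) :
  [/\ finite_set [set zs | constructed nu x V sel zs],
      (forall zs, output nu x V sel zs -> is_jet_frame x V zs)
    & exists2 zs, output nu x V sel zs & is_minimal_jet_frame nu x V zs].
Proof.
have [n [a [b [_ VE]]]] := polyV; rewrite -/(halfspaces a b) in VE; subst V.
have [Vx supp] := suppV.
have fin := finite_built Vx supp selP.
have out_jet zs : output nu x (halfspaces a b) sel zs ->
    is_jet_frame x (halfspaces a b) zs.
  move=> /(output_cone Vx supp selP)[bz c0].
  have [f _] := built_frame Vx supp selP bz.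
  by apply: conic_frame_jet_frame; rewrite ?c0.
split=> //.
have built0 := constructed_nil nu x (halfspaces a b) sel.
have [z0] := built_output Vx supp selP built0.
rewrite cat0s => out0.
have : finite_set (output nu x (halfspaces a b) sel).
  by apply: sub_finite_set fin => zs [].
case/finite_seqP => s sE; have s0 : z0 \in s by move: out0; rewrite sE.
have [zs zs_s min] := lex_minimum (angle_seq nu) s0.
have out_zs : output nu x (halfspaces a b) sel zs by rewrite sE.
exists zs => //; split=> [|zs' jet']; first exact: out_jet.
(* A jet frame may stop before its cone is zero; it is completed first. *)
have lin := jet_frame_linear Vx jet'.
have f' := (partial_jet_frameP Vx zs').1 jet'.1.
have [ts [fts cts nuts]] := linear_frame_extension nu f' lin.
have [us out_us le_us] := built_competitive Vx supp selP built0
  (zs' := [::]) fts cts (nonpositive_nil Vx supp)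
  erefl (fun=> iff_refl _) erefl.
have us_s : us \in s by move: out_us; rewrite sE.
rewrite cat0s in le_us.
apply: lex_le_trans (min _ us_s) _; apply: lex_le_trans le_us _.
exact: angle_seq_cat_le.
Qed.
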